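(* Let $r$ be a positive integer, let $P$ be an $r$-differential poset, and let $n,k\in\mathbb{N}=\{0,1,2,\dots\}$ with $n\ge 1$. Then for every $x\in P_n$, $$e(x)\,(rn)^k=\sum_{y\in P_{n-1}} m_{k+\frac12}(x\rightarrow y)\,e(y).$$
   Context: Let $r\ge 1$ be an integer. A poset $P$ is called $r$-differential if: (D1) $P$ is locally finite, graded, and has a minimum element $\hat 0$; (D2) if $x\neq y$ in $P$ and there are exactly $k$ elements of $P$ covered by both $x$ and $y$, then there are exactly $k$ elements of $P$ which cover both $x$ and $y$; (D3) if $x\in P$ covers exactly $k$ elements of $P$, then $x$ is covered by exactly $k+r$ elements of $P$. Let $\rho$ be the rank function of $P$ (with $\rho(\hat 0)=0$, and $\rho(y)=\rho(x)+1$ whenever $y$ covers $x$), and let $P_n=\{x\in P:\rho(x)=n\}$. For $x\in P$, $e(x)$ denotes the number of saturated chains from $\hat 0$ to $x$ (so $e(\hat 0)=1$). For $x\in P_n$ and $y\in P_{n-1}$, a down-up alternating walk of length $2k+1$ from $x$ to $y$ is a sequence $x=y_0\ge y_{1/2}\le y_1\ge y_{3/2}\le y_2\ge\cdots\ge y_{k-1/2}\le y_k\ge y_{k+1/2}=y$ of elements of $P$ such that any two consecutive elements are adjacent in the Hasse diagram of $P$ (so $y_i\in P_n$ and $y_{i+1/2}\in P_{n-1}$ for integers $i$). $m_{k+\frac12}(x\rightarrow y)$ denotes the number of such walks. *)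

(* Defs.v *)
From mathcomp Require Import all_boot all_order finmap.
From mathcomp Require Import all_classical.

Set Implicit Arguments.
Unset Strict Implicit.
Unset Printing Implicit Defensive.

Import Order.Theory.
Local Open Scope classical_set_scope.
Local Open Scope card_scope.
Local Open Scope nat_scope.

Definition covers d (T : porderType d) (y x : T) : Prop :=
  (x < y)%O /\ forall z : T, ~ ((x < z)%O /\ (z < y)%O).

Definition locally_finite d (T : porderType d) : Prop :=
  forall x y : T, finite_set [set z : T | (x <= z)%O /\ (z <= y)%O].

(* In a locally finite poset with minimum \bot, at most one function rho
   satisfies this. *)
Definition is_rank d (T : bPOrderType d) (rho : T -> nat) : Prop :=
  rho \bot%O = 0 /\ forall x y : T, covers y x -> rho y = (rho x).+1.

Definition graded d (T : bPOrderType d) : Prop :=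
  exists rho : T -> nat, is_rank rho.

(* The minimum element is part of the structure bPOrderType.  "Exactly k
   elements" is equipotence with `I_k = [set i | i < k]. *)
Record differential d (T : bPOrderType d) (r : nat) : Prop := {
  diff_locally_finite : locally_finite T;
  diff_graded : graded T;
  diff_common_covers : forall (x y : T) (k : nat), x <> y ->
    [set z : T | covers x z /\ covers y z] #= `I_k ->
    [set z : T | covers z x /\ covers z y] #= `I_k;
  diff_covers : forall (x : T) (k : nat),
    [set z : T | covers x z] #= `I_k ->
    [set z : T | covers z x] #= `I_(k + r)
}.

(* [fset_set A] is empty when A is infinite, hence so is the count; all the
   sets counted below are finite when T is r-differential. *)
Definition card_set (U : choiceType) (A : set U) : nat :=
  #|` fset_set A|%fset.

Definition rank_level (T : Type) (rho : T -> nat) (n : nat) : set T :=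
  [set x | rho x = n].

(* The chain \bot < s_0 < s_1 < ... is represented by the sequence s. *)
Definition saturated_chains d (T : bPOrderType d) (x : T) : set (seq T) :=
  [set s | path (fun u v : T => `[< covers v u >]) \bot%O s
           /\ last \bot%O s = x].

Definition nb_chains d (T : bPOrderType d) (x : T) : nat :=
  card_set (saturated_chains x).

(* The walk x = y_0 >= y_{1/2} <= y_1 >= ... <= y_k >= y_{k+1/2} = y is
   represented by the tuple w of its 2k+2 terms, with w_j = y_{j/2}; the
   default value of nth is never used. *)
Definition alt_walks d (T : porderType d) (k : nat) (x y : T) :
    set (k.*2.+2.-tuple T) :=
  [set w | [/\ nth x w 0 = x,
               nth x w k.*2.+1 = y,
               forall i, i <= k -> covers (nth x w i.*2) (nth x w i.*2.+1) &
               forall i, i < k -> covers (nth x w i.*2.+2) (nth x w i.*2.+1)]].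
Arguments alt_walks {d T} k x y.

Definition nb_walks d (T : porderType d) (k : nat) (x y : T) : nat :=
  card_set (alt_walks k x y).

(* Main.v *)
Require Import Defs.
From mathcomp Require Import all_boot all_order finmap.
From mathcomp Require Import all_classical.

Set Implicit Arguments.
Unset Strict Implicit.
Unset Printing Implicit Defensive.

Import Order.Theory.
Local Open Scope classical_set_scope.
Local Open Scope card_scope.
Local Open Scope nat_scope.

(** Let [U] send an element to the formal sum of the elements covering it and
    [D] to the formal sum of the elements it covers.  Axioms (D2) and (D3) say
    exactly that [D U - U D = r]: off the diagonal, the coefficients of [D U]
    and [U D] count common upper and common lower covers, and on the diagonal
    they count all upper and all lower covers ([big_up_down], [DU_UD]).

    A saturated chain to [x] is a saturated chain to some [z] covered by [x],
    followed by [x], so [e(x)] is the sum of the [e(z)] ([nb_chains_rec]).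
    Combined with the commutation relation, an induction on the rank shows
    that [e] is an eigenvector of going up and back down: for [y] of rank
    [n - 1], the sum of [e(x)] over the [x] covering [y] is [r n e(y)]
    ([sum_upper_chains]).  Indeed the commutation contributes [r e(y)],
    and the induction hypothesis at the elements covered by [y] contributes
    [r (n - 1) e(y)].

    Finally let [S_k(x)] be the sum over [y] of the walks of length [2k+1]
    from [x] to [y], weighted by [e(y)].  Then [S_0 = e] by the recursion for
    chains.  The first two steps of a longer walk go from [x] down to some [a]
    and up to some [b], whence [S_(k+1)(x)] is the sum of the [S_k(b)]
    ([nb_walks_rec]).  If [S_k = (r n)^k e] on rank [n], the eigenvector
    property sums the [b] above each [a] to [r n e(a) (r n)^k], and summing
    over [a] gives [(r n)^(k+1) e(x)] ([sum_walks_chains]).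

    The poset may be infinite, but every rank level is finite: (D3) bounds the
    number of upper covers, and every element of positive rank covers one of
    the rank below ([finite_level]).  All sums run over these levels. *)

(** * Cardinals of finite sets *)

Lemma card_set_seq (U : choiceType) (A : set U) (s : seq U) :
  uniq s -> (forall u, A u <-> u \in s) -> finite_set A /\ card_set A = size s.
Proof.
move=> us As; have eA : A = [set` s] by apply/seteqP; split=> u /As.
have fA : finite_set A by rewrite eA; exact: finite_seq.
split=> //; apply/perm_size/uniq_perm; rewrite ?fset_uniq // => u.
by rewrite in_fset_set // eA; apply/idP/idP; rewrite inE.
Qed.

(** Cardinality of a disjoint union of images.  It is the tool for both
    recursions below, chains being split by their last but one element and
    walks by their second and third elements.  Finiteness comes along because
    it is proved by the same recursions. *)
Lemma card_set_fibers (I : eqType) (V U : choiceType) (s : seq I)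
    (B : I -> set V) (f : I -> V -> U) (A : set U) :
    uniq s -> (forall i, i \in s -> finite_set (B i)) ->
    (forall i j u v, B i u -> B j v -> f i u = f j v -> i = j /\ u = v) ->
    (forall a, A a <-> exists i u, [/\ i \in s, B i u & a = f i u]) ->
  finite_set A /\ card_set A = \sum_(i <- s) card_set (B i).
Proof.
move=> us fB injf As.
have inB i u : i \in s -> u \in enum_fset (fset_set (B i)) <-> B i u.
  by move=> si; have /= -> := in_fset_set (fB i si) u; rewrite inE.
have := @card_set_seq _ A [seq f i u | i <- s, u <- enum_fset (fset_set (B i))].
rewrite size_allpairs_dep sumnE big_map; apply.
  apply: allpairs_uniq_dep => // _ _ /allpairsPdep[i [u [si Bu ->]]]
    /allpairsPdep[j [v [sj Bv ->]]] /=.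
  by case/(injf _ _ _ _ ((inB _ _ si).1 Bu) ((inB _ _ sj).1 Bv)) => -> ->.
move=> a; split=> [/As[i [u [si Bu ->]]]|/allpairsPdep[i [u [si Bu ->]]]].
  by apply/allpairsPdep; exists i, u; split=> //; apply/inB.
by apply/As; exists i, u; split=> //; apply/inB.
Qed.

Lemma card_set_card_eq (U : choiceType) (A : set U) :
  finite_set A -> A #= `I_(card_set A).
Proof. by move=> /finite_setP[n An]; rewrite /card_set (card_fset_set An). Qed.

(** * Rank levels of a differential poset *)

Section Differential.

Context (d : Order.disp_t) (T : bPOrderType d) (r : nat) (hT : differential T r).
Context (rho : T -> nat) (hrho : is_rank rho).

Implicit Types (x y z w : T) (n k : nat).

Definition cov x y : bool := `[< covers x y >].

Definition level n : seq T := fset_set (rank_level rho n).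

Lemma covP x y : reflect (covers x y) (cov x y).
Proof. exact: asboolP. Qed.

Lemma rank_cov x y : cov x y -> rho x = (rho y).+1.
Proof. by move=> /covP; case: hrho => _; apply. Qed.

(** Any element strictly between [z] and [x] gives a smaller interval below
    [x], so local finiteness lets one climb from [z] to a lower cover. *)
Lemma exists_cover z x : (z < x)%O -> exists y, cov x y.
Proof.
pose itv z := [set y : T | (z <= y)%O /\ (y <= x)%O].
have fin z' : finite_set (itv z') by exact: (diff_locally_finite hT).
have [m] := ubnP (card_set (itv z)); elim: m z => // m IH z.
rewrite ltnS => zm zx.
have [xz|] := boolP (cov x z); first by exists z.
move=> /covP/not_andP[//|/existsNP[w /contrapT[zw wx]]].
apply: (IH w) => //; apply: leq_trans zm; apply/fproper_ltn_card/andP; split.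
  rewrite -fset_set_sub // => y [wy yx]; split=> //.
  exact: le_trans (ltW zw) wy.
apply/negP; rewrite -fset_set_sub // => /(_ z)[|wz _].
  by split=> //; exact: ltW.
by have := lt_le_trans zw wz; rewrite ltxx.
Qed.

Lemma rank0 x : rho x = 0 -> x = \bot%O.
Proof.
move=> rx; apply/eqP/negPn/negP; rewrite -lt0x => /exists_cover[y /rank_cov].
by rewrite rx.
Qed.

Lemma lower_cover n x : rho x = n.+1 -> exists2 y, cov x y & rho y = n.
Proof.
move=> rx; have /exists_cover[y xy] : (\bot < x)%O.
  by rewrite lt0x; apply/eqP => x0; move: rx; rewrite x0 (proj1 hrho).
by exists y => //; have := rank_cov xy; rewrite rx => -[].
Qed.

Lemma finite_lower x : finite_set [set z | covers x z].
Proof.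
apply: (sub_finite_set _ (diff_locally_finite hT \bot%O x)) => z [/ltW zx _].
by split=> //; exact: le0x.
Qed.

Lemma card_upper x :
  [set z | covers z x] #= `I_(card_set [set z | covers x z] + r).
Proof. exact/(diff_covers hT)/card_set_card_eq/finite_lower. Qed.

Lemma finite_upper x : finite_set [set z | covers z x].
Proof. by apply/finite_setP; eexists; exact: card_upper. Qed.

(** Each level lies in the union of the finitely many upper covers of the
    level below it. *)
Lemma finite_level n : finite_set (rank_level rho n).
Proof.
elim: n => [|n IH].
  by apply: (sub_finite_set _ (finite_set1 \bot%O)) => x /rank0.
apply: (sub_finite_set _ (bigcup_finite IH (fun y _ => finite_upper y))) => x.
by move=> /lower_cover[y /covP xy ry]; exists y.
Qed.

Lemma mem_level n x : (x \in level n) = (rho x == n).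
Proof.
by rewrite (in_fset_set (finite_level n)); apply/idP/eqP; rewrite inE.
Qed.

Lemma uniq_level n : uniq (level n).
Proof. exact: fset_uniq. Qed.

Lemma card_set_level (A : set T) (P : pred T) n :
  (forall x, A x <-> P x /\ rho x = n) ->
  finite_set A /\ card_set A = \sum_(x <- level n | P x) 1.
Proof.
move=> AP; rewrite sum1_count -size_filter.
apply: card_set_seq; first exact/filter_uniq/uniq_level.
move=> x; rewrite mem_filter mem_level; split=> [/AP[-> ->]|/andP[Px /eqP rx]].
  exact: eqxx.
exact/AP.
Qed.

(** * The commutation relation *)

(** The matrix entries of [D U = U D + r]: (D2) is the case [z != y] and (D3)
    the case [z = y].  At rank 0 the level [n.-1] is again level 0, which is
    harmless since nothing in it is covered by [y]. *)
Lemma big_up_down n y z : rho y = n -> rho z = n ->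
  \sum_(x <- level n.+1 | cov x y && cov x z) 1 =
  \sum_(w <- level n.-1 | cov y w && cov z w) 1 + (z == y) * r.
Proof.
move=> ry rz.
have [|fD <-] := @card_set_level [set w | covers y w /\ covers z w]
    (fun w => cov y w && cov z w) n.-1.
  move=> w; split=> [[/covP yw /covP zw]|].
    by rewrite yw zw; move: (rank_cov yw); rewrite ry => ->.
  by move=> [/andP[/covP yw /covP zw] _].
have [|_ <-] := @card_set_level [set w | covers w y /\ covers w z]
    (fun w => cov w y && cov w z) n.+1.
  move=> w; split=> [[/covP yw /covP zw]|].
    by rewrite yw zw (rank_cov yw) ry.
  by move=> [/andP[/covP yw /covP zw] _].
apply: card_fset_set; case: eqVneq => [->|zy].
  have idS (A : set T) : [set w | A w /\ A w] = A.
    by apply/seteqP; split=> w // [].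
  by rewrite mul1n !(idS (fun w => covers _ w)) !(idS (fun w => covers w _));
    exact: card_upper.
rewrite mul0n addn0; apply: (diff_common_covers hT); last exact: card_set_card_eq.
by apply/eqP; rewrite eq_sym.
Qed.

(** The commutation relation applied to an arbitrary function [f]. *)
Lemma DU_UD n y (f : T -> nat) : rho y = n ->
  \sum_(x <- level n.+1 | cov x y) \sum_(z <- level n | cov x z) f z =
  r * f y +
  \sum_(w <- level n.-1 | cov y w) \sum_(z <- level n | cov z w) f z.
Proof.
move=> ry.
have sumE (s : seq T) (P : pred T) (Q : rel T) :
    \sum_(x <- s | P x) \sum_(z <- level n | Q x z) f z =
    \sum_(z <- level n) (\sum_(x <- s | P x && Q x z) 1) * f z.
  under eq_bigr do rewrite big_mkcond.
  rewrite exchange_big; apply: eq_bigr => z _.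
  by rewrite big_distrl big_mkcondr; apply: eq_bigr => x _; rewrite /= mul1n.
rewrite (sumE _ _ cov) (sumE _ _ (fun w z => cov z w)).
have -> : r * f y = \sum_(z <- level n) (z == y) * r * f z.
  rewrite (bigD1_seq y) ?uniq_level ?mem_level ?ry //= eqxx mul1n.
  by rewrite big1 ?addn0 // => z /negPf ->.
rewrite -big_split; apply: eq_big_seq => z; rewrite mem_level => /eqP rz.
by rewrite (big_up_down ry rz) mulnDl addnC.
Qed.

(** * Counting saturated chains *)

Lemma saturated_chains_bot : saturated_chains (\bot%O : T) = [set [::]].
Proof.
apply/seteqP; split=> [s [ps ls]|_ -> //].
(* Ranks increase by one along a chain, so a closed chain has length 0. *)
suff: rho (last \bot%O s) = rho (\bot%O : T) + size s.
  by rewrite ls -{1}[rho _]addn0 => /addnI/esym/size0nil.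
elim: s (\bot%O : T) ps {ls} => [|x s IH] y; first by rewrite addn0.
by case/andP=> /rank_cov xy /IH /= ->; rewrite xy addSnnS.
Qed.

(** The finiteness hypothesis is discharged by [finite_chains], whose
    induction step is the first half of this conclusion. *)
Lemma card_chains n x :
    (forall z, rho z = n -> finite_set (saturated_chains z)) ->
    rho x = n.+1 ->
  finite_set (saturated_chains x) /\
  nb_chains x = \sum_(z <- level n | cov x z) nb_chains z.
Proof.
move=> fin rx; rewrite -big_filter.
apply: (@card_set_fibers _ _ _ _ (fun z => saturated_chains z)
          (fun=> rcons^~ x)).
- exact/filter_uniq/uniq_level.
- by move=> z; rewrite mem_filter mem_level => /andP[_ /eqP/fin].
- by move=> y z s t [_ yE] [_ zE] /rcons_inj[st]; rewrite -yE -zE st.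
case/lastP=> [|s w]; split.
- by case=> _ /= x0; move: rx; rewrite -x0 (proj1 hrho).
- by case=> ? [? [_ _ /(congr1 size)]]; rewrite size_rcons.
- case; rewrite rcons_path last_rcons => /andP[ps /asboolP wl] wx.
  rewrite wx in wl *.
  exists (last \bot%O s), s; split=> //; rewrite mem_filter mem_level.
  have xl : cov x (last \bot%O s) by exact/covP.
  by rewrite xl /= -eqSS -(rank_cov xl) rx.
- move=> [z [t [+ [pt lt] ->]]]; rewrite mem_filter => /andP[/covP xz _].
  split; rewrite ?last_rcons // rcons_path pt lt; exact/asboolP.
Qed.

Lemma finite_chains n x : rho x = n -> finite_set (saturated_chains x).
Proof.
elim: n x => [|n IH] x => [/rank0 ->|rx]; last by have [] := card_chains IH rx.
by rewrite saturated_chains_bot; exact: finite_set1.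
Qed.

Lemma nb_chains_rec n x : rho x = n.+1 ->
  nb_chains x = \sum_(z <- level n | cov x z) nb_chains z.
Proof. by move=> /(card_chains (@finite_chains n))[]. Qed.

(** Expand each [e(x)] over the lower covers of [x] and commute.  This leaves
    [r e(y)] and the sum, over the lower covers [w] of [y], of the same quantity
    one rank lower; by induction the latter is [r n] times the sum of
    [e] over the lower covers of [y], that is, [r n e(y)]. *)
Lemma sum_upper_chains n y : rho y = n ->
  \sum_(x <- level n.+1 | cov x y) nb_chains x = r * n.+1 * nb_chains y.
Proof.
elim: n y => [|n IH] y ry; rewrite big_seq_cond;
  under eq_bigr => x /andP[+ _] do
    (rewrite mem_level => /eqP/nb_chains_rec ->);
  rewrite -big_seq_cond (DU_UD _ ry).
  by rewrite big1 ?addn0 ?muln1 // => w /rank_cov; rewrite ry.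
rewrite big_seq_cond; under eq_bigr => w /andP[+ _] do
  (rewrite mem_level => /eqP/IH ->).
rewrite -big_seq_cond -big_distrr -nb_chains_rec //.
by rewrite -mulnDl [in RHS]mulnS.
Qed.

(** * Counting alternating walks *)

Lemma alt_walks0 x y :
  alt_walks 0 x y = if cov x y then [set [tuple x; y]] else set0.
Proof.
apply/seteqP; split=> w.
  move=> [w0 w1 /(_ 0 isT)]; rewrite w0 w1 => /covP -> _ /=.
  case: w w0 w1 => -[|a [|b []]] //= sw <- <-; exact/val_inj.
case: covP => // xy -> ; split=> // -[|i] //.
Qed.

(** A walk of length [2k+3] from [x] is [x], some [a], then a walk of length
    [2k+1] from some [b]; peeling off the beginning rather than the end keeps
    the endpoint [y] fixed and matches the induction on [k]. *)
Lemma card_walks n k x y :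
    (forall b, rho b = n.+1 -> finite_set (alt_walks k b y)) ->
    rho x = n.+1 ->
  finite_set (alt_walks k.+1 x y) /\
  nb_walks k.+1 x y =
  \sum_(a <- level n | cov x a) \sum_(b <- level n.+1 | cov b a) nb_walks k b y.
Proof.
move=> fin rx.
pose s := [seq (a, b) | a <- [seq a <- level n | cov x a],
                        b <- [seq b <- level n.+1 | cov b a]].
have sP a b : (a, b) \in s <-> cov x a /\ cov b a.
  split=> [/allpairsPdep[a' [b' [+ + [-> ->]]]]|[xa ba]].
    by rewrite !mem_filter => /andP[-> _] /andP[-> _].
  apply/allpairsPdep; exists a, b; rewrite !mem_filter !mem_level xa ba.
  have ra : rho a = n by apply/eqP; rewrite -eqSS -(rank_cov xa) rx.
  by rewrite (rank_cov ba) ra !eqxx.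
have -> : \sum_(a <- level n | cov x a)
    \sum_(b <- level n.+1 | cov b a) nb_walks k b y =
    \sum_(p <- s) nb_walks k p.2 y.
  rewrite big_allpairs_dep big_filter; apply: eq_bigr => a _.
  by rewrite big_filter.
apply: (@card_set_fibers _ _ (k.+1.*2.+2.-tuple T) s
  (fun p => alt_walks k p.2 y)
  (fun p (w : k.*2.+2.-tuple T) => [tuple of x :: p.1 :: w])
  (alt_walks k.+1 x y)).
- apply: allpairs_uniq_dep => [|a _|[a b] [a' b'] _ _ /= [-> ->] //];
    exact/filter_uniq/uniq_level.
- move=> [a b] /sP[xa ba]; apply: fin.
  by rewrite (rank_cov ba) -(rank_cov xa) rx.
- move=> [a b] [a' b'] /= u v [u0 _ _ _] [v0 _ _ _] [-> uv].
  have {}uv : u = v by exact/val_inj.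
  by rewrite -u0 -v0 uv; split=> //; congr (_, _); apply: set_nth_default;
    rewrite size_tuple.
(* Terms of a walk from [b] are read with default [b], those of a walk from
   [x] with default [x]; the bounds below keep every index in range, where
   both readings agree. *)
have leS i : i <= k -> i.*2 < k.*2.+2.
  by move=> ik; rewrite ltnS leqW // leq_double.
have leS1 i : i <= k -> i.*2.+1 < k.*2.+2.
  by move=> ik; rewrite !ltnS leq_double.
move=> w; split.
  case: w => -[|x' [|a w]] //= sw [/= x'E wy wd wu]; subst x'.
  have sw' : size w == k.*2.+2 by move: sw; rewrite /= !eqSS.
  have nthE i b : i < k.*2.+2 -> nth x w i = nth b w i.
    by move=> ik; apply: set_nth_default; rewrite (eqP sw').
  pose b := nth x w 0.
  exists (a, b), (Tuple sw'); split; last exact/val_inj.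
    apply/sP; split; apply/covP; first exact: wd 0 isT.
    exact: wu 0 isT.
  split=> /= [||i ik|i ik].
  - exact/esym/nthE.
  - by rewrite -nthE.
  - by rewrite -!nthE ?leS ?leS1 //; exact: wd i.+1 ik.
  - have ikS := ltnW ik.
    by rewrite -!nthE ?leS1 ?(leS i.+1) //; exact: wu i.+1 ik.
move=> [[a b] [u [/sP[/covP xa /covP ba] /= [u0 uy ud uu] ->]]].
have nthE i : i < k.*2.+2 -> nth x u i = nth b u i.
  by move=> ik; apply: set_nth_default; rewrite size_tuple.
split=> //=.
- by rewrite nthE.
- case=> [|i] // ik; rewrite doubleS /= !nthE ?leS ?leS1 //; exact: ud.
case=> [|i] ik /=; first by rewrite nthE ?u0.
rewrite !nthE ?leS1 ?(leS i.+1) //; [exact: uu | exact: ltnW].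
Qed.

Lemma finite_walks n k x y : rho x = n.+1 -> finite_set (alt_walks k x y).
Proof.
elim: k x => [|k IH] x rx; last by have [] := card_walks IH rx.
by rewrite alt_walks0; case: ifP => _; [exact: finite_set1|exact: finite_set0].
Qed.

Lemma nb_walks0 x y : nb_walks 0 x y = cov x y.
Proof.
rewrite /nb_walks /card_set alt_walks0; case: cov.
  by rewrite fset_set1 cardfs1.
by rewrite fset_set0 cardfs0.
Qed.

Lemma nb_walks_rec n k x y : rho x = n.+1 ->
  nb_walks k.+1 x y =
  \sum_(a <- level n | cov x a) \sum_(b <- level n.+1 | cov b a) nb_walks k b y.
Proof.
by move=> rx; have [] := card_walks (fun b => @finite_walks n k b y) rx.
Qed.

(** [e] is an eigenvector, for the eigenvalue [r n], of the down-up step with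
    which walks are extended. *)
Lemma sum_walks_chains n k x : rho x = n.+1 ->
  \sum_(y <- level n) nb_walks k x y * nb_chains y =
  nb_chains x * (r * n.+1) ^ k.
Proof.
elim: k x => [|k IH] x rx.
  rewrite muln1 (nb_chains_rec rx) [RHS]big_mkcond.
  by apply: eq_bigr => y _; rewrite nb_walks0; case: cov; rewrite ?mul1n.
under eq_bigr do (rewrite (nb_walks_rec _ _ rx) big_distrl;
  under eq_bigr do rewrite big_distrl).
rewrite exchange_big /=.
under eq_bigr do rewrite exchange_big /=.
rewrite (nb_chains_rec rx) expnS big_distrl /= big_seq_cond [RHS]big_seq_cond.
apply: eq_bigr => a /andP[]; rewrite mem_level => /eqP ra _.
transitivity (\sum_(b <- level n.+1 | cov b a) nb_chains b * (r * n.+1) ^ k).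
  by rewrite big_seq_cond [RHS]big_seq_cond; apply: eq_bigr => b /andP[+ _];
    rewrite mem_level => /eqP/IH.
by rewrite -big_distrl sum_upper_chains //= mulnA [nb_chains a * _]mulnC.
Qed.

End Differential.

Theorem corollary4 (d : Order.disp_t) (T : bPOrderType d) (r : nat)
    (hr : 1 <= r) (hT : differential T r)
    (rho : T -> nat) (hrho : is_rank rho)
    (n k : nat) (hn : 1 <= n) (x : T) (hx : rank_level rho n x) :
  nb_chains x * (r * n) ^ k =
  \big[addn/0]_(y \in rank_level rho n.-1) (nb_walks k x y * nb_chains y).
Proof.
case: n hn hx => // n _ rx /=.
rewrite fsbig_finite; first exact/esym/(sum_walks_chains hT hrho).
exact: (finite_level hT hrho).
Qed.
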